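(* Let $\mathcal{M}$ be an $H$-MBQC with symmetry group $H$, input group $Q$, output function $o:Q\to\mathbb{Z}_2$ and resource state $\rho$. Then for every $h\in H$, the transformed computation $h(\mathcal{M})$ computes the same function $o$ with the same average probability of success as $\mathcal{M}$; that is, $\overline{P}^{(h)}_o(\rho)=\overline{P}_o(\rho)$ for all $h\in H$.
   Context: Observables. Fix a finite-dimensional Hilbert space. $\mathcal{O}$ is a set of observables (Hermitian operators with eigenvalues $\pm1$ only), the directly measurable ones, with $A\in\mathcal{O}\Leftrightarrow -A\in\mathcal{O}$. A resolution of an observable $X$ in $\mathcal{O}$ is a product $X=A_1(A_2(\cdots(A_{K-1}A_K)))$, $K\ge 1$, $A_i\in\mathcal{O}$, such that with $B_i:=\prod_{l=i+1}^K A_l$ (in this order) $[A_i,B_i]=0$ for $i=1,\dots,K-1$. $\mathcal{I}$ is the set of all observables having a resolution in $\mathcal{O}$; it is closed under $A\mapsto -A$. $E$ is the set of classes $\{A,-A\}$, $A\in\mathcal{I}$; for each $a\in E$ a representative $T_a\in\mathcal{I}$ is fixed, so $\mathcal{I}=\{\pm T_a: a\in E\}$. $E_{\mathcal{O}}:=\{a\in E: T_a\in\mathcal{O}\}$. For $a\in E_{\mathcal{O}}$, $b\in E$ with $[T_a,T_b]=0$, $a\oplus b\in E$ is defined by $T_{a\oplus b}=\pm T_aT_b$ (when instead $b\in E_{\mathcal{O}}$, $a\oplus b$ likewise denotes the class of $\pm T_aT_b$). Input group. $Q$ is a finite group acting on $E$ such that (i) $qa\in E_{\mathcal{O}}$ for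 all $a\in E_{\mathcal{O}}$, $q\in Q$; (ii) $q(a\oplus b)=qa\oplus qb$ for all $q\in Q$ and all $a,b\in E$ with $[T_a,T_b]=0$ and $a\in E_{\mathcal{O}}$ or $b\in E_{\mathcal{O}}$. A sequence of distinct edges $a_1,\dots,a_n\in E_{\mathcal{O}}$ is fixed, forming the set $\mathcal{E}_{\rm e}=\{a_1,\dots,a_n\}$, such that $a_{\rm e}:=a_1\oplus(a_2\oplus\cdots\oplus(a_{n-1}\oplus a_n))$ is defined. $E_0:=\{qa_{\rm e}: q\in Q\}$. Products $\prod_{a\in\mathcal{E}_{\rm e}}$ are taken in the order $a_1,\dots,a_n$. Symmetry group. For a function $o:Q\to\mathbb{Z}_2$ let $\mathcal{R}_o:=\{(-1)^{o(q)}\prod_{a\in\mathcal{E}_{\rm e}}T_{qa}: q\in Q\}$. There is a function $\chi:E_0\to\mathbb{Z}_2$ with $\mathcal{R}_o=\{(-1)^{\chi(x)}T_x: x\in E_0\}$. $H$ is a group acting on the set $\mathcal{I}$ such that $h(-A)=-h(A)$ for all $A\in\mathcal{I}$, and (1) $h(A)\in\mathcal{O}$ for all $A\in\mathcal{O}$; (2) $h(A)h(B)=h(AB)$ for all $A,B\in\mathcal{I}$ with $[A,B]=0$ and $AB\in\mathcal{I}$; (3) $h(\mathcal{R}_o)=\mathcal{R}_o$, for all $h\in H$. These data, together with a resource state (density matrix) $\rho$, constitute an $H$-MBQC with output function $o$. Computation. To run $\mathcal{M}$ on input $q\in Q$ with resource state $\rho$: measure (projectively, sequentially) the observables $T_{qa_1},\dots,T_{qa_n}$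 on $\rho$, recording outcomes $s(qa_i)\in\mathbb{Z}_2$ (measured eigenvalue $(-1)^{s(qa_i)}$), and output $\sum_i s(qa_i)\bmod 2$. To run $h(\mathcal{M})$ on input $q$: do the same with the observables $h(T_{qa_1}),\dots,h(T_{qa_n})$ in place of $T_{qa_1},\dots,T_{qa_n}$. $\overline{P}_o(\rho)$ (respectively $\overline{P}^{(h)}_o(\rho)$) is the probability that the output of $\mathcal{M}$ (respectively $h(\mathcal{M})$) equals $o(q)$, averaged uniformly over $q\in Q$. *)

(* Defs.v *)
From mathcomp Require Export all_boot all_order all_fingroup all_algebra.
From mathcomp Require Export boolp classical_sets reals.
From mathcomp Require Export complex.
Export Order.TTheory GRing.Theory Num.Theory.

Set Implicit Arguments.
Unset Strict Implicit.
Unset Printing Implicit Defensive.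

Open Scope classical_set_scope.
Open Scope sesquilinear_scope.
Open Scope complex_scope.
Open Scope ring_scope.

(* The finite-dimensional Hilbert space is C^d with its standard inner
   product, and operators are the d x d matrices over C = R[i]. *)
Notation op R d := 'M[R[i]]_d.

Definition observable (R : realType) (d : nat) (A : op R d) : Prop :=
  A \is hermsymmx /\ (forall l, eigenvalue A l -> l = 1 \/ l = -1).

Definition density (R : realType) (d : nat) (rho : op R d) : Prop :=
  [/\ rho \is hermsymmx,
      forall v : 'cV[R[i]]_d, 0 <= (v^t* *m rho *m v) 0 0 &
      \tr rho = 1].

(* X = A_1 (A_2 (... A_K)), where each A_i commutes with the product B_i of
   the factors to its right. *)
Definition resolution (R : realType) (d : nat) (O : set (op R d)) (X : op R d)
    (As : seq (op R d)) : Prop :=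
  [/\ (0 < size As)%N,
      {in As, forall A, O A},
      X = \prod_(A <- As) A &
      forall i, (i.+1 < size As)%N ->
        comm_mx (nth 0 As i) (\prod_(A <- drop i.+1 As) A)].

Definition inferable (R : realType) (d : nat) (O : set (op R d)) : set (op R d) :=
  [set X | observable X /\ exists As, resolution O X As].

Definition class (R : realType) (d : nat) (A : op R d) : set (op R d) :=
  [set B | B = A \/ B = - A].

Definition edges (R : realType) (d : nat) (O : set (op R d)) :
    set (set (op R d)) :=
  [set class A | A in inferable O].

(* T chooses a representative of each edge. *)
Definition obs_edges (R : realType) (d : nat) (O : set (op R d))
    (T : set (op R d) -> op R d) : set (set (op R d)) :=
  [set a | edges O a /\ O (T a)].

(* a (+) b, written as a total function; it is meaningful only for commuting
   T a, T b with a or b in obs_edges, in which case it is again an edge, the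
   only one whose representative is T a *m T b up to sign. *)
Definition oplus (R : realType) (d : nat) (T : set (op R d) -> op R d)
    (a b : set (op R d)) : set (op R d) :=
  class (T a *m T b).

(* a_1 (+) (a_2 (+) ... (a_{n-1} (+) a_n)); the empty case is junk. *)
Fixpoint oplus_seq (R : realType) (d : nat) (T : set (op R d) -> op R d)
    (s : seq (set (op R d))) : set (op R d) :=
  match s with
  | [::] => set0
  | [:: a] => a
  | a :: s' => oplus T a (oplus_seq T s')
  end.

(* Every (+) occurring in [oplus_seq T s] is between edges whose
   representatives commute. *)
Definition oplus_seq_defined (R : realType) (d : nat)
    (T : set (op R d) -> op R d) (s : seq (set (op R d))) : Prop :=
  (0 < size s)%N /\
  forall i, (i.+1 < size s)%N ->
    comm_mx (T (nth set0 s i)) (T (oplus_seq T (drop i.+1 s))).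

(* Left action of G on the set S; the values of act outside S are irrelevant. *)
Definition acts_on (G : groupType) (X : Type) (S : set X) (act : G -> X -> X) :
    Prop :=
  [/\ forall g x, S x -> S (act g x),
      forall x, S x -> act 1%g x = x &
      forall g h x, S x -> act (g * h)%g x = act g (act h x)].

Definition output_ops (R : realType) (d : nat) (Q : finGroupType)
    (T : set (op R d) -> op R d) (Qact : Q -> set (op R d) -> set (op R d))
    (s : seq (set (op R d))) (o : Q -> 'Z_2) : set (op R d) :=
  [set (-1) ^+ o q *: \prod_(a <- s) T (Qact q a) | q in [set: Q]].

Record HMBQC (R : realType) (d : nat) (Q : finGroupType) (H : groupType)
    (o : Q -> 'Z_2) (rho : op R d) := {
  direct : set (op R d);
  direct_observable : forall A, direct A -> observable A;
  direct_opp : forall A, direct A <-> direct (- A);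
  edge_rep : set (op R d) -> op R d;
  edge_rep_class : forall a, edges direct a -> a (edge_rep a);
  actQ : Q -> set (op R d) -> set (op R d);
  actQ_action : acts_on (edges direct) actQ;
  actQ_obs : forall q a, obs_edges direct edge_rep a ->
    obs_edges direct edge_rep (actQ q a);
  (* The left-hand side is an edge, so edge_rep (actQ q a) *m
     edge_rep (actQ q b) is Hermitian: the two representatives commute and
     the sum on the right is a genuine one. *)
  actQ_oplus : forall q a b, edges direct a -> edges direct b ->
    comm_mx (edge_rep a) (edge_rep b) ->
    obs_edges direct edge_rep a \/ obs_edges direct edge_rep b ->
    actQ q (oplus edge_rep a b) = oplus edge_rep (actQ q a) (actQ q b);
  edge_seq : seq (set (op R d));
  edge_seq_uniq : uniq edge_seq;
  edge_seq_obs : {in edge_seq, forall a, obs_edges direct edge_rep a};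
  edge_seq_defined : oplus_seq_defined edge_rep edge_seq;
  (* E_0 = { q a_e : q in Q }; only the values of chi on E_0 matter. *)
  chi_exists : exists chi : set (op R d) -> 'Z_2,
    output_ops edge_rep actQ edge_seq o =
      [set (-1) ^+ chi x *: edge_rep x
        | x in [set actQ q (oplus_seq edge_rep edge_seq) | q in [set: Q]]];
  actH : H -> op R d -> op R d;
  actH_action : acts_on (inferable direct) actH;
  actH_opp : forall h A, inferable direct A -> actH h (- A) = - actH h A;
  actH_obs : forall h A, direct A -> direct (actH h A);
  actH_mul : forall h A B, inferable direct A -> inferable direct B ->
    comm_mx A B -> inferable direct (A *m B) ->
    actH h A *m actH h B = actH h (A *m B);
  actH_output : forall h,
    actH h @` output_ops edge_rep actQ edge_seq o =
      output_ops edge_rep actQ edge_seq o;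
  resource_density : density rho
}.

(* Orthogonal projector onto the (-1)^s-eigenspace of the Hermitian A.
   [eigenspace] and [proj_ortho] are about row vectors; taking adjoints, this
   same matrix, acting on columns, is the orthogonal projector onto the
   column eigenspace. *)
Definition eigenproj (R : realType) (d : nat) (A : op R d) (s : 'Z_2) : op R d :=
  proj_ortho (eigenspace A ((-1) ^+ s)).

(* Joint probability of the outcomes ss when the observables As are measured
   successively on rho, the head of As first (Born rule, each state left
   unnormalised after collapse). It is a nonnegative real, kept in C. *)
Definition outcome_prob (R : realType) (d : nat) (rho : op R d)
    (As : seq (op R d)) (ss : seq 'Z_2) : R[i] :=
  \tr (foldl (fun r As => eigenproj As.1 As.2 *m r *m eigenproj As.1 As.2)
         rho (zip As ss)).

Definition parity_prob (R : realType) (d : nat) (rho : op R d)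
    (As : seq (op R d)) (b : 'Z_2) : R[i] :=
  \sum_(ss : (size As).-tuple 'Z_2 | \sum_(s <- ss) s == b)
    outcome_prob rho As ss.

Definition avg_success (R : realType) (d : nat) (Q : finGroupType)
    (o : Q -> 'Z_2) (rho : op R d) (meas : Q -> seq (op R d)) : R[i] :=
  #|Q|%:R^-1 * \sum_(q : Q) parity_prob rho (meas q) (o q).

Definition measured (R : realType) (d : nat) (Q : finGroupType) (H : groupType)
    (o : Q -> 'Z_2) (rho : op R d) (M : HMBQC H o rho) (q : Q) : seq (op R d) :=
  [seq edge_rep M (actQ M q a) | a <- edge_seq M].

Definition measured_by (R : realType) (d : nat) (Q : finGroupType)
    (H : groupType) (o : Q -> 'Z_2) (rho : op R d) (M : HMBQC H o rho) (h : H)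
    (q : Q) : seq (op R d) :=
  [seq actH M h (edge_rep M (actQ M q a)) | a <- edge_seq M].

(* Main.v *)
(* Let X = A_1 ... A_n be a resolution. The spectral projectors P_s of A_1
   commute with B = A_2 ... A_n, so sum_s (-1)^s P_s B P_s = A_1 B; iterating,
   the outcomes of the successive measurements sum to b with probability
   (tr rho + (-1)^b tr (X rho)) / 2. On input q the success probability is thus
   an affine function of tr (r_q rho), where r_q = (-1)^o(q) prod_a T_(qa), and
   h replaces r_q by h(r_q). The class of r_q is q a_e, and the sign function
   chi makes r_q a function of q a_e: the fibers of q |-> r_q are the left cosets
   of the stabilizer of a_e, hence all of the same size. Since h permutes
   R_o = { r_q : q in Q }, the average over Q is unchanged. *)
Require Import Defs.

Set Implicit Arguments.
Unset Strict Implicit.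
Unset Printing Implicit Defensive.

(** * Observables as Hermitian involutions *)

Lemma hermsymmxP (R : realType) (d : nat) (A : op R d) :
  reflect (A^t* = A) (A \is hermsymmx).
Proof.
by apply: (iffP (is_hermitianmxP _ _ _)); rewrite expr0 scale1r => /esym.
Qed.

Lemma adjmxM (R : realType) (m n p : nat) (A : 'M[R[i]]_(m, n))
    (B : 'M[R[i]]_(n, p)) :
  (A *m B)^t* = B^t* *m A^t*.
Proof. by rewrite trmx_mul map_mxM. Qed.

Lemma observable_sqr (R : realType) (d : nat) (A : op R d) :
  observable A -> A *m A = 1%:M.
Proof.
case=> hA eA; have /orthomx_spectralP E := hermitian_normalmx hA.
set P := spectralmx A in E; set D := spectral_diag A in E.
have uP : P \in unitmx by exact: spectral_unit.
suff DD : diag_mx D *m diag_mx D = 1%:M.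
  by rewrite E !mulmxA mulmxK // -[_ *m _ *m diag_mx D]mulmxA DD mulmx1 mulVmx.
rewrite mulmx_diag; apply/matrixP => i j; rewrite !mxE; congr (_ *+ _).
have [] : D 0 i = 1 \/ D 0 i = -1; last 2 first.
- by move=> ->; rewrite mulr1.
- by move=> ->; rewrite mulrNN mulr1.
(* Row [i] of the unitary [P] is a nonzero row eigenvector of [A] for [D 0 i]. *)
apply: eA; apply/eigenvalueP; exists (delta_mx 0 i *m P).
  rewrite E !mulmxA mulmxK // scalemxAl; congr (_ *m _).
  by rewrite -rowE row_diag_mx.
apply/eqP => /(congr1 (mulmx^~ (invmx P))); rewrite mulmxK // mul0mx.
by move/matrixP/(_ 0 i)/eqP; rewrite !mxE !eqxx oner_eq0.
Qed.

Lemma involutive_observable (R : realType) (d : nat) (A : op R d) :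
  A \is hermsymmx -> A *m A = 1%:M -> observable A.
Proof.
move=> hA AA; split=> // l /eigenvalueP[v vA v0].
have : l ^+ 2 *: v == v.
  by rewrite expr2 -scalerA -!vA scalemxAl -vA -mulmxA AA mulmx1.
rewrite -subr_eq0 -[X in _ - X]scale1r -scalerBl scaler_eq0 (negPf v0) orbF.
by rewrite subr_eq0 sqrf_eq1 => /orP[] /eqP; [left | right].
Qed.

Lemma observableN (R : realType) (d : nat) (A : op R d) :
  observable A -> observable (- A).
Proof.
move=> obsA; have [hA _] := obsA.
apply: involutive_observable; last by rewrite mulNmx mulmxN opprK observable_sqr.
by apply/hermsymmxP; rewrite linearN /= map_mxN (hermsymmxP _ hA).
Qed.

Lemma observableM (R : realType) (d : nat) (A B : op R d) :
  observable A -> observable B -> comm_mx A B -> observable (A *m B).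
Proof.
move=> obsA obsB cAB; have [hA _] := obsA; have [hB _] := obsB.
apply: involutive_observable.
  by apply/hermsymmxP; rewrite adjmxM !(hermsymmxP _ _) // cAB.
rewrite {2}cAB mulmxA -(mulmxA A) observable_sqr // mulmx1.
exact: observable_sqr.
Qed.

(** Taking adjoints, the Hermitian product [A *m B] equals [B *m A]. *)
Lemma observableM_comm (R : realType) (d : nat) (A B : op R d) :
  observable A -> observable B -> observable (A *m B) -> comm_mx A B.
Proof.
move=> [hA _] [hB _] [hAB _].
by rewrite /comm_mx -(hermsymmxP _ hAB) adjmxM !(hermsymmxP _ _).
Qed.

(** * Spectral projectors and collapse *)

Lemma Z2_split (R : pzRingType) (s : 'Z_2) : ((-1) ^+ s : R) = 1 \/ ((-1) ^+ s : R) = -1.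
Proof. by case: s => [[|[|//]] ?] /=; rewrite ?expr0 ?expr1; [left | right]. Qed.

(** Let [P] be the right-hand side. Its rows lie in the eigenspace and those of [1%:M - P] are
    orthogonal to it, so the orthogonal projector fixes the former and kills the latter. *)
Lemma eigenprojE (R : realType) (d : nat) (A : op R d) (s : 'Z_2) :
  observable A -> eigenproj A s = 2^-1 *: (1%:M + (-1) ^+ s *: A).
Proof.
move=> obsA; have [hA _] := obsA; have AA := observable_sqr obsA.
rewrite /eigenproj; set e : R[i] := (-1) ^+ s; set U := eigenspace A e.
have ee : e * e = 1 by rewrite /e -expr2 sqrr_sign.
have n2 : (2 : R[i]) != 0 by rewrite pnatr_eq0.
set P : op R d := _ *: _.
have PU : (P <= U)%MS.
  apply/eigenspaceP; rewrite /P -scalemxAl mulmxDl mul1mx -scalemxAl AA.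
  rewrite scalerA mulrC -scalerA; congr (_ *: _).
  by rewrite scalerDr scalerA ee scale1r addrC.
have PO : (1%:M - P <= orthomx Num.Def.conjC 1%:M U)%MS.
  apply/orthomx1P.
  have UA : U *m A = e *: U by apply/eigenspaceP.
  have AU : A *m U^t* = e *: U^t*.
    have := congr1 (fun X => X^t*) UA; rewrite adjmxM (hermsymmxP _ hA) => ->.
    rewrite linearZ /= map_mxZ; congr (_ *: _).
    by rewrite /= /e rmorph_sign.
  rewrite mulmxBl mul1mx /P -scalemxAl mulmxDl mul1mx -scalemxAl AU scalerA ee.
  rewrite scale1r -mulr2n -[X in _ *: (X *+ 2)]scale1r scalerMnl scalerA.
  by rewrite -[1 *+ 2]/(2%:R) mulVf // scale1r subrr.
rewrite -[LHS]mul1mx -[X in X *m _](subrK P) mulmxDl proj_ortho_0 // add0r.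
exact: proj_ortho_id PU.
Qed.

Lemma scaler_halfK (F : numFieldType) (V : lmodType F) (v : V) :
  2^-1 *: (v + v) = v.
Proof. by rewrite -mulr2n -scaler_nat scalerA mulVf ?pnatr_eq0 // scale1r. Qed.

Lemma sum_eigenproj (R : realType) (d : nat) (A : op R d) :
  observable A -> \sum_(s : 'Z_2) eigenproj A s = 1%:M.
Proof.
move=> obsA; rewrite big_ord_recl big_ord1 !eigenprojE // -scalerDr.
rewrite expr0 expr1 scale1r scaleN1r addrACA subrr addr0.
exact: scaler_halfK.
Qed.

Lemma signed_sum_eigenproj (R : realType) (d : nat) (A : op R d) :
  observable A -> \sum_(s : 'Z_2) (-1) ^+ s *: eigenproj A s = A.
Proof.
move=> obsA; rewrite big_ord_recl big_ord1 !eigenprojE //.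
rewrite expr0 expr1 !scale1r !scaleN1r -scalerBr opprB (addrC 1%:M A).
rewrite addrACA subrr addr0.
exact: scaler_halfK.
Qed.

Lemma eigenproj_idem (R : realType) (d : nat) (A : op R d) (s : 'Z_2) :
  eigenproj A s *m eigenproj A s = eigenproj A s.
Proof. exact: proj_ortho_proj. Qed.

Lemma mxtrace_mul_idem_comm (R : comPzRingType) (n : nat) (P B C : 'M[R]_n) :
  P *m P = P -> comm_mx P B -> \tr (B *m (P *m C *m P)) = \tr (P *m B *m C).
Proof.
by move=> PP cPB; rewrite !mulmxA mxtrace_mulC !mulmxA cPB -(mulmxA B P P) PP.
Qed.

Lemma trace_collapse (R : realType) (d : nat) (A rho : op R d) :
  observable A ->
  \sum_(s : 'Z_2) \tr (eigenproj A s *m rho *m eigenproj A s) = \tr rho.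
Proof.
move=> obsA; rewrite -{2}(mul1mx rho) -(sum_eigenproj obsA) mulmx_suml raddf_sum.
by apply: eq_bigr => s _; rewrite mxtrace_mulC mulmxA eigenproj_idem.
Qed.

(** The projectors of [A] are affine in [A], hence commute with [B]; cyclicity of the trace then
    merges the two copies of each projector, and their signed sum is [A]. *)
Lemma signed_trace_collapse (R : realType) (d : nat) (A B rho : op R d) :
  observable A -> comm_mx A B ->
  \sum_(s : 'Z_2) (-1) ^+ s * \tr (B *m (eigenproj A s *m rho *m eigenproj A s)) =
  \tr (A *m B *m rho).
Proof.
move=> obsA cAB.
rewrite -[in RHS](signed_sum_eigenproj obsA) -mulmxA mulmx_suml raddf_sum.
apply: eq_bigr => s _; rewrite mxtrace_mul_idem_comm ?eigenproj_idem //.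
  by rewrite -[in RHS]scalemxAl mulmxA; symmetry; exact: mxtraceZ.
rewrite eigenprojE // /comm_mx -scalemxAl -scalemxAr mulmxDl mulmxDr.
by rewrite -scalemxAl -scalemxAr mul1mx mulmx1 cAB.
Qed.

(** * Parity of the outcomes of successive measurements *)

Lemma parity_prob_nil (R : realType) (d : nat) (rho : op R d) (b : 'Z_2) :
  parity_prob rho [::] b = 2^-1 * (\tr rho + (-1) ^+ b * \tr rho).
Proof.
have n2 : (2 : R[i]) != 0 by rewrite pnatr_eq0.
rewrite /parity_prob; case: b => [[|[|//]] ?] /=.
  rewrite (big_pred1 [tuple]) => [|t].
    by rewrite expr0 mul1r -mulr2n -(mulr_natl (\tr rho)) mulKf.
  by rewrite (tuple0 t) /= big_nil.
by rewrite big_pred0 => [|t]; rewrite ?expr1 ?mulN1r ?subrr ?mulr0 // (tuple0 t) big_nil.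
Qed.

(** Splitting on the first outcome [s]: the remaining ones must sum to [b - s]. *)
Lemma parity_prob_cons (R : realType) (d : nat) (rho A : op R d)
    (As : seq (op R d)) (b : 'Z_2) :
  parity_prob rho (A :: As) b =
  \sum_(s : 'Z_2)
    parity_prob (eigenproj A s *m rho *m eigenproj A s) As (b - s).
Proof.
rewrite /parity_prob [RHS]pair_big_dep /=.

rewrite (reindex (fun p : 'Z_2 * (size As).-tuple 'Z_2 => cons_tuple p.1 p.2)) /=.
  by apply: eq_big => [[s t] | //]; rewrite /= big_cons [RHS]eq_sym subr_eq addrC eq_sym.
exists (fun t => (thead t, behead_tuple t)) => [[s t] | t] _ /=.
  by congr pair; apply: val_inj.
by rewrite [RHS]tuple_eta; apply: val_inj.
Qed.

Lemma parity_prob_cons_comm (R : realType) (d : nat) (A B : op R d)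
    (As : seq (op R d)) :
  observable A -> comm_mx A B ->
  (forall rho b, parity_prob rho As b =
    2^-1 * (\tr rho + (-1) ^+ b * \tr (B *m rho))) ->
  forall rho b, parity_prob rho (A :: As) b =
    2^-1 * (\tr rho + (-1) ^+ b * \tr (A *m B *m rho)).
Proof.
move=> obsA cAB IH rho b; rewrite parity_prob_cons.
under eq_bigr do rewrite IH.
rewrite -mulr_sumr big_split /= trace_collapse //; congr (_ * (_ + _)).
rewrite -(signed_trace_collapse rho obsA cAB) mulr_sumr.
apply: eq_bigr => s _; rewrite mulrA; congr (_ * _).
(* The sign of [b - s] is the product of the signs of [b] and [s], checked on the four cases. *)
by case: b s => [[|[|//]] ?] [[|[|//]] ?]; rewrite /= ?expr0 ?expr1 ?mul1r ?mulrNN ?mulr1.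
Qed.

(** * Resolutions and inferable observables *)

Section Resolution.
Variables (R : realType) (d : nat) (O : set (op R d)).
Implicit Types (A B X : op R d) (As : seq (op R d)).

Lemma resolution1 A : O A -> resolution O A [:: A].
Proof.
move=> OA; split=> // [B|]; first by rewrite inE => /eqP->.
by rewrite big_seq1.
Qed.

Lemma resolution_cons A B As :
  O A -> resolution O B As -> comm_mx A B -> resolution O (A *m B) (A :: As).
Proof.
move=> OA [_ OAs -> cAs] cAB; split=> // [C | | [|i]] /=.
- by rewrite inE => /predU1P[-> | /OAs].
- by rewrite big_cons.
- by rewrite drop0.
- by rewrite ltnS; apply: cAs.
Qed.

(** Dropping the head of a resolution of length at least two leaves a resolution of the product of
    the tail, so induction can start from singletons. *)
Lemma resolution_ind (P : op R d -> seq (op R d) -> Prop) :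
  (forall A, O A -> P A [:: A]) ->
  (forall A B As, O A -> resolution O B As -> comm_mx A B -> P B As ->
    P (A *m B) (A :: As)) ->
  forall X As, resolution O X As -> P X As.
Proof.
move=> P1 Pcons X As; elim: As X => [|A As IH] X [// _ OAs -> cAs].
have OA : O A by apply: OAs; rewrite mem_head.
rewrite big_cons; case: As => [|B As] in IH OAs cAs *.
  by rewrite big_nil mulr1; apply: P1.
have res : resolution O (\prod_(C <- B :: As) C) (B :: As).
  split=> // [C CAs | i ltAs]; first by apply: OAs; rewrite inE CAs orbT.
  exact: (cAs i.+1).
by apply: Pcons => //; [exact: (cAs 0 isT) | exact: IH].
Qed.

Hypothesis obsO : forall A, O A -> observable A.

Lemma resolution_observable X As : resolution O X As -> observable X.
Proof.
move=> res.
elim/resolution_ind: X As / res => [A /obsO // | A B As /obsO obsA _ cAB obsB].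
exact: observableM.
Qed.

Lemma resolution_inferable X As : resolution O X As -> inferable O X.
Proof. by move=> res; split; [exact: resolution_observable res | exists As]. Qed.

Lemma parity_prob_resolution X As : resolution O X As ->
  forall rho b, parity_prob rho As b =
    2^-1 * (\tr rho + (-1) ^+ b * \tr (X *m rho)).
Proof.
move=> res; elim/resolution_ind: X As / res => [A OA | A B As OA _ cAB IH].
  (* A single measurement is read as [A *m 1%:M], with an empty tail of product 1. *)
  move=> rho b; rewrite -{2}(mulmx1 A); move: rho b; apply: parity_prob_cons_comm.
  - exact: obsO.
  - exact: comm_mx1.
  - by move=> rho b; rewrite mul1mx parity_prob_nil.
by apply: parity_prob_cons_comm => //; apply: obsO.
Qed.

Hypothesis oppO : forall A, O A <-> O (- A).

(** Negating the first factor of a resolution of [X] preserves all the commutations. *)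
Lemma inferableN X : inferable O X -> inferable O (- X).
Proof.
case=> _ [As res]; suff [Bs /resolution_inferable //] : exists Bs, resolution O (- X) Bs.
elim/resolution_ind: X As / res => [A /oppO OA | A B As /oppO OA res cAB _].
  by exists [:: - A]; apply: resolution1.
exists (- A :: As); rewrite -mulNmx; apply: resolution_cons => //.
by rewrite /comm_mx mulNmx mulmxN cAB.
Qed.

Lemma inferable_sign X (s : 'Z_2) : inferable O X -> inferable O ((-1) ^+ s *: X).
Proof.
case: (Z2_split R[i] s) => -> infX; first by rewrite scale1r.
by rewrite scaleN1r; apply: inferableN.
Qed.

End Resolution.

(** * Classes up to sign, and a counting lemma *)

Lemma class_id (R : realType) (d : nat) (A : op R d) : class A A.
Proof. by left. Qed.

Lemma classN (R : realType) (d : nat) (A : op R d) : class (- A) = class A.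
Proof.
apply/seteqP; split=> B [] ->; rewrite ?opprK; by [left | right; rewrite ?opprK].
Qed.

Lemma class_sign (R : realType) (d : nat) (A : op R d) (s : 'Z_2) :
  class ((-1) ^+ s *: A) = class A.
Proof. by case: (Z2_split R[i] s) => ->; rewrite ?scale1r // scaleN1r classN. Qed.

Lemma class_eq (R : realType) (d : nat) (A B : op R d) : class A B -> class B = class A.
Proof. by case=> ->; rewrite ?classN. Qed.

Lemma class_mulmxr (R : realType) (d : nat) (A B C : op R d) :
  class B = class C -> class (A *m B) = class (A *m C).
Proof.
move=> eBC; have : class C B by rewrite -eBC; apply: class_id.
by case=> ->; rewrite ?mulmxN ?classN.
Qed.

(* Double counting of the pairs (q, q') with r q' = g (r q). *)
Lemma sum_uniform_fibers (I : finType) (T : eqType) (F : numFieldType)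
    (r : I -> T) (g : T -> T) (f : T -> F) (N : nat) :
  (0 < N)%N ->
  (forall i, #|[pred j | r j == r i]| = N) ->
  (forall i, exists j, g (r i) = r j) ->
  (forall i, exists j, r i = g (r j)) ->
  (forall i j, g (r i) = g (r j) -> r i = r j) ->
  \sum_i f (g (r i)) = \sum_i f (r i).
Proof.
move=> N0 fibN gr rg injg.
apply: (@mulfI _ N%:R); first by rewrite pnatr_eq0 -lt0n.
rewrite !mulr_sumr.
transitivity (\sum_i \sum_(j | r j == g (r i)) f (r j)).
  apply: eq_bigr => i _; have [k ->] := gr i.
  rewrite (eq_bigr (fun=> f (r k))) => [|j /eqP-> //].
  by rewrite sumr_const fibN mulr_natl.
rewrite (exchange_big_dep predT) //=; apply: eq_bigr => j _.
(* With [r j = g (r k)], injectivity turns the inner index set into the fiber of [r k], which has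
   [N] elements. *)
have [k ->] := rg j.
rewrite sumr_const -(fibN k) mulr_natl; congr (_ *+ _); apply: eq_card => i.
rewrite !inE; apply/eqP/eqP => [/injg-> // | -> //].
Qed.

(** * The computation and its transform under the symmetry group *)

Section Computation.
Variables (R : realType) (d : nat) (Q : finGroupType) (H : groupType).
Variables (o : Q -> 'Z_2) (rho : op R d) (M : HMBQC H o rho).
Local Notation O := (direct M).
Local Notation T := (edge_rep M).
Local Notation "q ** a" := (actQ M q a) (at level 40).

Lemma class_edge_rep a : edges O a -> class (T a) = a.
Proof. by move=> ea; have := edge_rep_class ea; case: ea => A _ <- /class_eq. Qed.

Lemma edge_rep_inferable a : edges O a -> inferable O (T a).
Proof.
move=> ea; have := edge_rep_class ea; case: ea => A infA <- [] -> //.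
exact: (inferableN (@direct_observable _ _ _ _ _ _ M) (@direct_opp _ _ _ _ _ _ M)).
Qed.

Lemma actQ_edge q a : edges O a -> edges O (q ** a).
Proof. by case: (actQ_action M) => + _ _; apply. Qed.

(** The claims are proved jointly by induction: the class of the tail product identifies the class
    of the whole product with an edge, which yields the commutation needed to extend the
    resolution. *)
Lemma oplus_seq_prod (s : seq (set (op R d))) :
  {in s, forall a, obs_edges O T a} -> oplus_seq_defined T s ->
  edges O (oplus_seq T s) /\
  forall q, resolution O (\prod_(a <- s) T (q ** a)) [seq T (q ** a) | a <- s] /\
    class (\prod_(a <- s) T (q ** a)) = q ** oplus_seq T s.
Proof.
have obsO := @direct_observable _ _ _ _ _ _ M.
elim: s => [|a s IH] obs_s [// _ comm_s].
have oa : obs_edges O T a by apply: obs_s; rewrite mem_head.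
have ea : edges O a by case: oa.
have oqa q : O (T (q ** a)) by case: (actQ_obs q oa).
case: s => [|b s] in IH obs_s comm_s *.
  split=> // q; rewrite big_seq1; split; first exact: resolution1.
  by rewrite /= class_edge_rep //; apply: actQ_edge.
have {IH}[] := IH.
- by move=> c cs; apply: obs_s; rewrite inE cs orbT.
- by split=> // i lt_i; apply: (comm_s i.+1).
set t := b :: s; set e := oplus_seq T t => ee IH.
have cae : comm_mx (T a) (T e) := comm_s 0 isT.
(* Prepending [T a] to a resolution of [T e] resolves the product. *)
have es : edges O (oplus T a e).
  have [_ [As res]] := edge_rep_inferable ee.
  exists (T a *m T e) => //.
  by apply: resolution_inferable obsO _ _ (resolution_cons _ res cae); case: oa.
split=> // q; have [res cls] := IH q; set X := \prod_(c <- t) _ in res cls *.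
have eqe := actQ_edge q ee.
have qae : q ** oplus T a e = oplus T (q ** a) (q ** e).
  by apply: actQ_oplus => //; left.
have clsX : class (T (q ** a) *m X) = class (T (q ** a) *m T (q ** e)).
  by apply: class_mulmxr; rewrite cls class_edge_rep.
rewrite big_cons -/X; split; last exact: etrans clsX (esym qae).
apply: resolution_cons => //.
(* q (a (+) e) is an edge, so its representative, which is T (q a) *m X up to
   sign, is Hermitian: the two factors commute. *)
apply: observableM_comm.
- exact: obsO.
- exact: resolution_observable res.
have := actQ_edge q es; rewrite qae /oplus -clsX => /[dup] eX /edge_rep_class.
have [obsTX _] := edge_rep_inferable eX.
case=> E; rewrite E in obsTX; first exact: obsTX.
by have := observableN obsTX; rewrite opprK.
Qed.

(** Every tail product is inferable, so [actH M h] is multiplicative at each step; the images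
    commute because both orders give the image of [A *m B]. *)
Lemma resolution_actH h X As : resolution O X As ->
  resolution O (actH M h X) [seq actH M h A | A <- As].
Proof.
have obsO := @direct_observable _ _ _ _ _ _ M.
move=> res; elim/resolution_ind: X As / res => [A OA | A B As OA res cAB IH].
  exact/resolution1/actH_obs.
have infA := resolution_inferable obsO (resolution1 OA).
have infB := resolution_inferable obsO res.
have infAB := resolution_inferable obsO (resolution_cons OA res cAB).
rewrite -actH_mul //; apply: resolution_cons => //; first exact: actH_obs.
by rewrite /comm_mx !actH_mul // -?cAB.
Qed.

Lemma actH_inj h A B : inferable O A -> inferable O B ->
  actH M h A = actH M h B -> A = B.
Proof.
have [_ act1 actM] := actH_action M => infA infB eAB.
by rewrite -(act1 A) // -(act1 B) // -(mulVg h) !actM // eAB.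
Qed.

Lemma actH_sign h (s : 'Z_2) A : inferable O A ->
  actH M h ((-1) ^+ s *: A) = (-1) ^+ s *: actH M h A.
Proof.
move=> infA; case: (Z2_split R[i] s) => ->; first by rewrite !scale1r.
by rewrite !scaleN1r actH_opp.
Qed.

(** The operator r_q; its values over [Q] form [output_ops]. *)
Definition output_op (q : Q) : op R d :=
  (-1) ^+ o q *: \prod_(a <- edge_seq M) T (q ** a).

Local Notation ae := (oplus_seq T (edge_seq M)).

Lemma edge_output : edges O ae.
Proof. by case: (oplus_seq_prod (@edge_seq_obs _ _ _ _ _ _ M) (edge_seq_defined M)). Qed.

Lemma resolution_measured q :
  resolution O (\prod_(a <- edge_seq M) T (q ** a)) (measured M q).
Proof.
by case: (oplus_seq_prod (@edge_seq_obs _ _ _ _ _ _ M) (edge_seq_defined M)) => _ /(_ q)[].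
Qed.

Lemma class_output_op q : class (output_op q) = q ** ae.
Proof.
rewrite class_sign.
by case: (oplus_seq_prod (@edge_seq_obs _ _ _ _ _ _ M) (edge_seq_defined M)) => _ /(_ q)[].
Qed.

Lemma output_op_eq q q' : (output_op q == output_op q') = (q ** ae == q' ** ae).
Proof.
have [chi outE] := chi_exists M.
have outchi p : output_op p = (-1) ^+ chi (p ** ae) *: T (p ** ae).
  have : output_ops T (actQ M) (edge_seq M) o (output_op p) by exists p.
  (* A priori the sign and representative come from some [p' ** ae]; comparing classes shows that
     this edge is [p ** ae]. *)
  rewrite outE => -[_ [p' _ <-] E].
  have := class_output_op p; rewrite -E class_sign class_edge_rep => [<- //|].
  exact/actQ_edge/edge_output.
apply/eqP/eqP => [/(congr1 (@class _ _)) | e]; first by rewrite !class_output_op.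
by rewrite !outchi e.
Qed.

Lemma card_output_op_fiber q :
  #|[pred p | output_op p == output_op q]| = #|[pred p | p ** ae == ae]|.
Proof.
have [_ act1 actM] := actQ_action M; have ee := edge_output.
(* The fiber through [q] is the left translate by [q] of the stabilizer of [ae]. *)
rewrite -(card_image (mulgI q) [pred p | p ** ae == ae]); apply: eq_card => p.
rewrite [LHS]inE output_op_eq; apply/eqP/idP => [e | /mapP[u]].
  apply/mapP.
  exists (q^-1 * p)%g; last by rewrite mulKVg.
  by rewrite mem_enum inE actM // e -actM // mulVg act1.
by rewrite mem_enum inE => ue ->; rewrite actM // ue.
Qed.

Lemma sum_output_op_actH h (F : numFieldType) (f : op R d -> F) :
  \sum_q f (actH M h (output_op q)) = \sum_q f (output_op q).
Proof.
have obsO := @direct_observable _ _ _ _ _ _ M.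
have infr q : inferable O (output_op q).
  apply: inferable_sign => //; first exact: direct_opp.
  exact: resolution_inferable (resolution_measured q).
have outH := actH_output M h.
apply: (@sum_uniform_fibers _ _ _ output_op (actH M h) f _ _ card_output_op_fiber).
(* The stabilizer contains 1; the next two goals are the two inclusions of the invariance of the set
   of output operators. *)
- apply/card_gt0P; exists 1%g; rewrite inE.
  by have [_ -> //] := actQ_action M; apply: edge_output.
- move=> q; have : (actH M h @` output_ops T (actQ M) (edge_seq M) o) (actH M h (output_op q)).
    by exists (output_op q) => //; exists q.
  by rewrite outH => -[p _ <-]; exists p.
- move=> q; have : output_ops T (actQ M) (edge_seq M) o (output_op q) by exists q.
  by rewrite -outH => -[_ [p _ <-] <-]; exists p.
- by move=> q q'; apply: actH_inj.
Qed.

(** Stated for arbitrary resolutions so as to cover both the original and the transformed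
    measurements. *)
Lemma avg_success_resolution (meas : Q -> seq (op R d)) (X : Q -> op R d) :
  (forall q, resolution O (X q) (meas q)) ->
  avg_success o rho meas =
  #|Q|%:R^-1 * \sum_q (2^-1 * (\tr rho + \tr ((-1) ^+ o q *: X q *m rho))).
Proof.
move=> res; congr (_ * _); apply: eq_bigr => q _.
rewrite (parity_prob_resolution (@direct_observable _ _ _ _ _ _ M) (res q)).
by rewrite -scalemxAl mxtraceZ.
Qed.

End Computation.

Theorem theorem2 (R : realType) (d : nat) (Q : finGroupType) (H : groupType)
    (o : Q -> 'Z_2) (rho : op R d) (M : HMBQC H o rho) (h : H) :
  avg_success o rho (measured_by M h) = avg_success o rho (measured M).
Proof.
rewrite (avg_success_resolution (resolution_measured M)).
rewrite (avg_success_resolution (M := M)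
  (X := fun q => actH M h (\prod_(a <- edge_seq M) edge_rep M (actQ M q a)))).
  congr (_ * _).
  (* Both averages evaluate this one affine function, at r_q and at h(r_q); the sign in r_q passes
     through h. *)
  rewrite -(sum_output_op_actH M h (fun X => 2^-1 * (\tr rho + \tr (X *m rho)))).
  apply: eq_bigr => q _; rewrite actH_sign //.
  apply: resolution_inferable (resolution_measured M q); exact: direct_observable.
move=> q; rewrite /measured_by (map_comp (actH M h)).
exact/resolution_actH/resolution_measured.
Qed.
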